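(* Let $(H,\langle\cdot,\cdot\rangle)$ be a real Hilbert space with norm $\|x\|=\sqrt{\langle x,x\rangle}$. For a closed subspace $V$ of $H$, let $P=P_V$ denote the orthogonal projection on $V$ (so $PH=V$), and define $$D(x,y|P)=\|Px\|\cdot\|Py\|+\|x-Px\|\cdot\|y-Py\|\qquad\text{for all }x,y\in H.$$ Then for every closed subspace $V$ of $H$, with $P=P_V$, $$|\langle x,y\rangle|\le D(x,y|P)\le \|x\|\cdot\|y\|\qquad\text{for all }x,y\in H.$$ Furthermore, let $\mathcal{P}$ denote the family of all orthogonal projections onto closed subspaces of $H$. Then for each pair $(x,y)\in H\times H$, $$D^{+}(x,y):=\sup_{P\in\mathcal{P}}D(x,y|P)=\|x\|\cdot\|y\|\qquad\text{and}\qquad D^{-}(x,y):=\inf_{P\in\mathcal{P}}D(x,y|P)=|\langle x,y\rangle|.$$ Consequently, for every orthogonal projection $P\in\mathcal{P}$, $D^{-}(x,y)\le D(x,y|P)\le D^{+}(x,y)$ for all $x,y\in H$.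
   Context: All closed subspaces are allowed, including $\{0\}$ and $H$ itself, so $\mathcal{P}$ includes the zero operator and the identity. *)

(* Defs.v *)
From HB Require Import structures.
From mathcomp Require Import all_boot all_order all_algebra.
From mathcomp Require Import all_classical all_reals all_analysis.

Set Implicit Arguments.
Unset Strict Implicit.
Unset Printing Implicit Defensive.

Import Order.TTheory GRing.Theory Num.Theory.
Import numFieldNormedType.Exports.
Local Open Scope classical_set_scope.
Local Open Scope ring_scope.

Section OrthogonalProjections.
Context {R : realType} {H : completeNormedModType R}.

Definition closed_subspace (V : set H) : Prop :=
  submod_closed [in V] /\ closed V.

(* A complete normed module whose norm comes from the inner product [dot] is a
   real Hilbert space; [{dot H for idfun}] is the type of positive definite
   symmetric bilinear forms on [H]. *)
Definition norm_of_dot (dot : {dot H for idfun}) : Prop :=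
  forall x : H, `|x| = Num.sqrt (dot x x).

Variable dot : {dot H for idfun}.

(* The point [p] of [V] with [x - p] orthogonal to [V]. It exists and is unique
   when [H] is a Hilbert space for [dot] and [V] is a closed subspace; the
   default value [0] is only used outside of this case. *)
Definition orthoproj (V : set H) (x : H) : H :=
  xget 0 [set p | V p /\ forall v, V v -> dot (x - p) v = 0].

Definition orthoprojs : set (H -> H) :=
  [set orthoproj V | V in closed_subspace].

Definition Dproj (P : H -> H) (x y : H) : R :=
  `|P x| * `|P y| + `|x - P x| * `|y - P y|.

Definition Dplus (x y : H) : R := sup [set Dproj P x y | P in orthoprojs].

Definition Dminus (x y : H) : R := inf [set Dproj P x y | P in orthoprojs].

End OrthogonalProjections.

(* Main.v *)
Require Import Defs.
From HB Require Import structures.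
From mathcomp Require Import all_boot all_order all_algebra.
From mathcomp Require Import all_classical all_reals all_analysis.
From mathcomp Require Import ring lra.
Set Implicit Arguments.
Unset Strict Implicit.

Import Order.TTheory GRing.Theory Num.Theory.
Import numFieldNormedType.Exports.
Local Open Scope classical_set_scope.
Local Open Scope ring_scope.

(** Write [p], [q] for the projections of [x], [y] onto a closed subspace.

The lower bound comes from splitting the inner product along the subspace and
its orthogonal complement: the cross terms of
[dot x y = dot p q + dot (x - p) (y - q)] vanish, and Cauchy-Schwarz applies to
each remaining term ([dot_le_Dproj]).  The upper bound is Cauchy-Schwarz in the
plane for the vectors [(|p|, |x - p|)] and [(|q|, |y - q|)], whose lengths are
[|x|] and [|y|] by Pythagoras ([Dproj_le]).

Both bounds are attained, so the supremum and the infimum are a maximum and a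
minimum.  The zero projection gives [|x| |y|] ([Dproj_0]).  The projection onto
the line spanned by [y] gives [|dot x y|]: it fixes [y], which kills the second
term of [D], and it maps [x] to [(dot x y / |y|^2) y] ([Dproj_line]).

All of this rests on the projection theorem ([orthoprojP]): by the parallelogram
identity a minimizing sequence for the distance from [x] to the subspace is
Cauchy, completeness and closedness give a nearest point, and the first-order
condition at a nearest point is orthogonality. *)

(** * The inner product and its norm *)

Section InnerProduct.
Variables (R : realType) (H : completeNormedModType R).
Variables (dot : {dot H for idfun}) (normE : norm_of_dot dot).
Implicit Types (x y u v w : H) (V : set H).

Lemma dotC x y : dot x y = dot y x.
Proof. by rewrite hermC expr0 mul1r. Qed.

Lemma dotDl x y v : dot (x + y) v = dot x v + dot y v.
Proof. exact: linearDl. Qed.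

Lemma dotBl x y v : dot (x - y) v = dot x v - dot y v.
Proof. exact: linearBl. Qed.

Lemma dotZl a x v : dot (a *: x) v = a * dot x v.
Proof. exact: linearZl_LR. Qed.

Lemma dotDr v x y : dot v (x + y) = dot v x + dot v y.
Proof. exact: linearDr. Qed.

Lemma dotBr v x y : dot v (x - y) = dot v x - dot v y.
Proof. exact: linearBr. Qed.

Lemma dotZr v a x : dot v (a *: x) = a * dot v x.
Proof. by rewrite dotC dotZl dotC. Qed.

Lemma dot0l v : dot 0 v = 0.
Proof. exact: linear0l. Qed.

Lemma dotxx x : dot x x = `|x| ^+ 2.
Proof.
rewrite normE sqr_sqrtr //; have [->|x0] := eqVneq x 0; first by rewrite dot0l.
exact/ltW/neq0_dnorm_gt0.
Qed.

Lemma sqr_normD x y : `|x + y| ^+ 2 = `|x| ^+ 2 + 2 * dot x y + `|y| ^+ 2.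
Proof. by rewrite -!dotxx !(dotDl, dotDr) (dotC y x); ring. Qed.

Lemma sqr_normB x y : `|x - y| ^+ 2 = `|x| ^+ 2 - 2 * dot x y + `|y| ^+ 2.
Proof. by rewrite -!dotxx !(dotBl, dotBr) (dotC y x); ring. Qed.

(** Cauchy-Schwarz: the identity in the proof exhibits [|y|^2] times the defect
[|x|^2 |y|^2 - (dot x y)^2] as the square of the norm of
[|y|^2 x - (dot x y) y]. *)
Lemma le_dot_norm x y : `|dot x y| <= `|x| * `|y|.
Proof.
have [->|y0] := eqVneq y 0; first by rewrite dotC dot0l !normr0 mulr0.
have y2 : 0 < `|y| ^+ 2 by rewrite exprn_gt0 ?normr_gt0.
rewrite -(@ler_pXn2r _ 2) ?nnegrE ?mulr_ge0 // real_normK ?num_real //.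
rewrite -subr_ge0 -(pmulr_rge0 _ y2).
suff -> : `|y| ^+ 2 * ((`|x| * `|y|) ^+ 2 - dot x y ^+ 2) =
  `| `|y| ^+ 2 *: x - dot x y *: y | ^+ 2 by exact: sqr_ge0.
rewrite -!dotxx !(dotBl, dotBr, dotZl, dotZr) (dotC y x) !dotxx; ring.
Qed.

(** Polarization reduces this to the continuity of the norm. *)
Lemma continuous_dotl v : continuous (dot^~ v).
Proof.
have -> : dot^~ v =
    fun x => 2^-1 * (`|x + v| * `|x + v| - `|x| * `|x| - `|v| * `|v|).
  by apply/funext => x; rewrite -!expr2 sqr_normD; field.
move=> x; apply: cvgMr; apply: cvgB; last exact: cvg_cst.
have cn (f : H -> H) : f @ x --> f x -> `|f z| @[z --> x] --> `|f x|.
  by move=> ?; exact: cvg_norm.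
apply: cvgB; apply: cvgM; apply: cn; rewrite ?cvg_id //;
  by apply: cvgD; [exact: cvg_id|exact: cvg_cst].
Qed.

(** * Closed subspaces *)

Definition orthocompl V : set H := [set u | forall v, V v -> dot u v = 0].

(** Holds for an arbitrary set [V], which provides the closed subspaces on which
the two extremal values are attained without any separate argument that a
finite-dimensional subspace is closed. *)
Lemma closed_subspace_orthocompl V : closed_subspace (orthocompl V).
Proof.
split.
  split; first by rewrite inE => v _; exact: dot0l.
  move=> a u w; rewrite !inE => uV wV v Vv.
  by rewrite dotDl dotZl uV ?wV // mulr0 addr0.
have -> : orthocompl V = \bigcap_(v in V) (dot^~ v @^-1` [set 0]).
  by apply/seteqP; split => u uV v /uV.
apply: closed_bigI => v _; apply: preimage_closed; last exact: closed_eq.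
by move=> x _; exact: continuous_dotl.
Qed.

Lemma subspaceD V u v : closed_subspace V -> V u -> V v -> V (u + v).
Proof.
move=> [[_ VP] _] Vu Vv; have := VP 1 u v.
by rewrite !inE scale1r => /(_ Vu Vv).
Qed.

Lemma subspaceZ V a u : closed_subspace V -> V u -> V (a *: u).
Proof.
move=> [[V0 VP] _] Vu; have := VP a u 0.
by rewrite inE in V0; rewrite !inE addr0; apply.
Qed.

Lemma subspaceB V u v : closed_subspace V -> V u -> V v -> V (u - v).
Proof.
by move=> sV Vu Vv; rewrite -scaleN1r; apply: subspaceD => //; exact: subspaceZ.
Qed.

Lemma subspace0 V : closed_subspace V -> V 0.
Proof. by case=> -[+ _] _; rewrite inE. Qed.

(** * The projection theorem *)

(** First-order condition: along the line [p + t v] the squared distance to [x]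
is [|x - p|^2 - 2 t c + t^2 |v|^2] with [c = dot (x - p) v], which is below
[|x - p|^2] for some [t] unless [c = 0]. *)
Lemma nearest_orthogonal V x p : closed_subspace V -> V p ->
  (forall v, V v -> `|x - p| <= `|x - v|) ->
  orthocompl V (x - p).
Proof.
move=> sV Vp pmin v Vv; have [->|v0] := eqVneq v 0.
  by rewrite dotC dot0l.
have v2 : 0 < `|v| ^+ 2 by rewrite exprn_gt0 ?normr_gt0.
(* The minimum of the quadratic in [t], lower than its value at [0] by
   [c^2 / |v|^2]. *)
set c := dot (x - p) v; pose t := c / `|v| ^+ 2.
have := pmin _ (subspaceD sV Vp (subspaceZ t sV Vv)).
rewrite -(@ler_pXn2r _ 2) ?nnegrE // opprD addrA (sqr_normB (x - p)) dotZr -/c.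
rewrite normrZ exprMn real_normK ?num_real //.
have -> : `|x - p| ^+ 2 - 2 * (t * c) + t ^+ 2 * `|v| ^+ 2 =
    `|x - p| ^+ 2 - c ^+ 2 / `|v| ^+ 2.
  by rewrite /t; field; rewrite normr_eq0.
rewrite lerBrDl gerDr pmulr_lle0 ?invr_gt0 // => c2.
by apply/eqP; rewrite -sqrf_eq0 eq_le c2 sqr_ge0.
Qed.

(** Two points of [V] that nearly minimize the distance to [x] are close to each
other: their midpoint is in [V], hence no closer to [x] than the minimum, and
the parallelogram identity for [x - u] and [x - v] bounds [u - v]. *)
Lemma minimizing_parallelogram V x u v d a b : closed_subspace V ->
  (forall w, V w -> d <= `|x - w| ^+ 2) -> V u -> V v ->
  `|x - u| ^+ 2 <= d + a -> `|x - v| ^+ 2 <= d + b ->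
  `|u - v| ^+ 2 <= 2 * (a + b).
Proof.
move=> sV dV Vu Vv ua vb.
have := dV _ (subspaceZ 2^-1 sV (subspaceD sV Vu Vv)).
have -> : x - 2^-1 *: (u + v) = 2^-1 *: ((x - u) + (x - v)).
  rewrite addrACA -opprD scalerBr (scalerDr _ x) -scalerDl; congr (_ - _).
  by rewrite -[LHS]scale1r; congr (_ *: _); field.
rewrite normrZ exprMn (sqr_normD (x - u)) real_normK ?num_real //.
have -> : u - v = (x - v) - (x - u) by rewrite opprB [RHS]addrC addrA subrK.
rewrite (sqr_normB (x - v)) (dotC (x - v)); lra.
Qed.

Lemma exists_nearest V x : closed_subspace V ->
  exists2 p, V p & forall v, V v -> `|x - p| <= `|x - v|.
Proof.
move=> sV; pose D := [set `|x - v| ^+ 2 | v in V].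
have infD : has_inf D.
  split; first by exists (`|x - 0| ^+ 2), 0 => //; exact: subspace0.
  by exists 0 => _ [v _ <-]; exact: sqr_ge0.
have dV w : V w -> inf D <= `|x - w| ^+ 2.
  by move=> Vw; apply: ge_inf; [exact: infD.2|exists w].
have /choice[u uP] n :
    exists v, V v /\ `|x - v| ^+ 2 <= inf D + n.+1%:R^-1.
  have [|_ [v Vv <-] /ltW vn] := inf_adherent (eps := n.+1%:R^-1) _ infD.
    by rewrite invr_gt0.
  by exists v.
have : cvg (u @ \oo).
  apply: cauchy_cvg; apply: cauchy_exP => e e0.
  (* Errors below [e^2 / 4] at both indices give a squared distance below
     [2 (e^2 / 4 + e^2 / 4) = e^2]. *)
  have e4 : 0 < e ^+ 2 / 4 by rewrite divr_gt0 ?exprn_gt0.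
  have [N _ NP] := near_infty_natSinv_lt (PosNum e4).
  exists (u N); exists N => // n Nn /=.
  rewrite -ball_normE /ball_ /= -(@ltr_pXn2r _ 2) ?nnegrE ?(ltW e0) //.
  have := minimizing_parallelogram sV dV (uP N).1 (uP n).1 (uP N).2 (uP n).2.
  have := NP N (leqnn N); have := NP n Nn; rewrite /=.
  by move: (n.+1%:R^-1) (N.+1%:R^-1) (`|u N - u n| ^+ 2) (e ^+ 2) => *; lra.
move=> /cvg_ex[/= p up]; exists p.
  by apply: closed_cvg up; [exact: sV.2|near=> n; exact: (uP n).1].
move=> v Vv; rewrite -(@ler_pXn2r _ 2) ?nnegrE //.
apply: (le_trans _ (dV _ Vv)).
have cl : `|x - u n| * `|x - u n| @[n --> \oo] --> `|x - p| * `|x - p|.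
  by apply: cvgM; apply: cvg_norm; apply: cvgB => //; exact: cvg_cst.
have cr : inf D + n.+1%:R^-1 @[n --> \oo] --> inf D + 0.
  by apply: cvgD; [exact: cvg_cst|exact: cvg_harmonic].
rewrite addr0 in cr; rewrite expr2.
apply: (ler_cvg_to cl cr).
by near=> n; rewrite -expr2; exact: (uP n).2.
Unshelve. all: by end_near. Qed.

Lemma orthoprojP V x : closed_subspace V ->
  V (orthoproj dot V x) /\ orthocompl V (x - orthoproj dot V x).
Proof.
move=> sV; have [p Vp pmin] := exists_nearest x sV.
have pP : V p /\ orthocompl V (x - p).
  by split => //; exact: nearest_orthogonal.
exact: (xgetI (P := [set q | V q /\ orthocompl V (x - q)]) 0 pP).
Qed.

Lemma orthoproj_unique V x p : closed_subspace V ->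
  V p -> orthocompl V (x - p) -> orthoproj dot V x = p.
Proof.
move=> sV Vp op; have [Vq oq] := orthoprojP x sV.
set q := orthoproj dot V x in Vq oq *.
have Vqp := subspaceB sV Vq Vp.
apply/eqP; rewrite -subr_eq0 -normr_eq0 -sqrf_eq0 -dotxx.
have {1}-> : q - p = (x - p) - (x - q) by rewrite opprB [RHS]addrC addrA subrK.
by rewrite dotBl op // oq // subrr.
Qed.

(** * Bounds for [Dproj] *)

Lemma sqr_norm_proj V x : closed_subspace V ->
  `|x| ^+ 2 = `|orthoproj dot V x| ^+ 2 + `|x - orthoproj dot V x| ^+ 2.
Proof.
move=> sV; have [Vp op] := orthoprojP x sV.
set p := orthoproj dot V x in Vp op *.
by rewrite -{1}(subrK p x) (sqr_normD (x - p)) op // mulr0 addr0 addrC.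
Qed.

Lemma Dproj_le V x y : closed_subspace V ->
  Dproj (orthoproj dot V) x y <= `|x| * `|y|.
Proof.
move=> sV; rewrite -(@ler_pXn2r _ 2) ?nnegrE ?addr_ge0 ?mulr_ge0 //.
rewrite exprMn (sqr_norm_proj x sV) (sqr_norm_proj y sV) /Dproj.
set a := `|_|; set b := `|_|; set c := `|_|; set d := `|_|.
rewrite -subr_ge0.
suff -> : (a ^+ 2 + c ^+ 2) * (b ^+ 2 + d ^+ 2) - (a * b + c * d) ^+ 2 =
  (a * d - b * c) ^+ 2 by exact: sqr_ge0.
ring.
Qed.

Lemma dot_le_Dproj V x y : closed_subspace V ->
  `|dot x y| <= Dproj (orthoproj dot V) x y.
Proof.
move=> sV; rewrite /Dproj.
have [Vp op] := orthoprojP x sV; have [Vq oq] := orthoprojP y sV.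
set p := orthoproj dot V x in Vp op *; set q := orthoproj dot V y in Vq oq *.
have -> : dot x y = dot p q + dot (x - p) (y - q).
  rewrite dotBr (op q) // subr0 dotBl addrCA -opprB -dotBr (dotC p).
  by rewrite oq // oppr0 addr0.
by apply: le_trans (ler_normD _ _) _; apply: lerD; exact: le_dot_norm.
Qed.

(** * Extremal projections *)

Lemma orthoproj_0 x : orthoproj dot (orthocompl setT) x = 0.
Proof.
apply: orthoproj_unique; first exact: closed_subspace_orthocompl.
  by move=> v _; exact: dot0l.
by move=> v vT; rewrite dotC vT.
Qed.

(** The double orthocomplement of [y] is the line spanned by [y], or [0] when
[y = 0]; in that case the formula is still correct, as both sides vanish. *)
Lemma orthoproj_line x y :
  orthoproj dot (orthocompl (orthocompl [set y])) x =
  (dot x y / `|y| ^+ 2) *: y.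
Proof.
apply: orthoproj_unique; first exact: closed_subspace_orthocompl.
  by move=> v yv; rewrite dotZl (dotC y) yv // mulr0.
move=> v vV; rewrite dotC; apply: vV => _ ->; rewrite dotBl dotZl dotxx.
have [->|y0] := eqVneq y 0.
  by rewrite normr0 expr0n mulr0 dotC dot0l subrr.
by rewrite divfK ?subrr // sqrf_eq0 normr_eq0.
Qed.

Lemma Dproj_0 x y : Dproj (orthoproj dot (orthocompl setT)) x y = `|x| * `|y|.
Proof. by rewrite /Dproj !orthoproj_0 !subr0 normr0 mul0r add0r. Qed.

Lemma Dproj_line x y :
  Dproj (orthoproj dot (orthocompl (orthocompl [set y]))) x y = `|dot x y|.
Proof.
rewrite /Dproj !orthoproj_line dotxx.
have [->|y0] := eqVneq y 0.
  by rewrite !scaler0 subrr normr0 !mulr0 addr0 dotC dot0l normr0.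
have y2 : `|y| ^+ 2 != 0 by rewrite sqrf_eq0 normr_eq0.
rewrite divff // scale1r subrr normr0 mulr0 addr0 normrZ normrM.
by rewrite (@ger0_norm _ (_^-1)) ?invr_ge0 ?sqr_ge0 // -mulrA -expr2 divfK.
Qed.

Lemma DplusE x y : Dplus dot x y = `|x| * `|y|.
Proof.
have ubD : ubound [set Dproj P x y | P in orthoprojs dot] (`|x| * `|y|).
  by move=> _ [_ [V sV <-] <-]; exact: Dproj_le.
have memD : [set Dproj P x y | P in orthoprojs dot] (`|x| * `|y|).
  exists (orthoproj dot (orthocompl setT)); last exact: Dproj_0.
  by exists (orthocompl setT) => //; exact: closed_subspace_orthocompl.
apply/eqP; rewrite eq_le; apply/andP; split.
  by apply: ge_sup => //; exists (`|x| * `|y|).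
by apply: ub_le_sup => //; exists (`|x| * `|y|).
Qed.

Lemma DminusE x y : Dminus dot x y = `|dot x y|.
Proof.
have lbD : lbound [set Dproj P x y | P in orthoprojs dot] `|dot x y|.
  by move=> _ [_ [V sV <-] <-]; exact: dot_le_Dproj.
have memD : [set Dproj P x y | P in orthoprojs dot] `|dot x y|.
  exists (orthoproj dot (orthocompl (orthocompl [set y]))).
    exists (orthocompl (orthocompl [set y])) => //.
    exact: closed_subspace_orthocompl.
  exact: Dproj_line.
apply/eqP; rewrite eq_le; apply/andP; split.
  by apply: ge_inf => //; exists `|dot x y|.
by apply: lb_le_inf => //; exists `|dot x y|.
Qed.

End InnerProduct.

Theorem proposition2p1 (R : realType) (H : completeNormedModType R)
    (dot : {dot H for idfun}) (normE : norm_of_dot dot) :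
  [/\ forall V : set H, closed_subspace V -> forall x y : H,
        `|dot x y| <= Dproj (orthoproj dot V) x y <= `|x| * `|y|,
      forall x y : H,
        Dplus dot x y = `|x| * `|y| /\ Dminus dot x y = `|dot x y|
    & forall P : H -> H, orthoprojs dot P -> forall x y : H,
        Dminus dot x y <= Dproj P x y <= Dplus dot x y].
Proof.
have bounds V : closed_subspace V -> forall x y : H,
    `|dot x y| <= Dproj (orthoproj dot V) x y <= `|x| * `|y|.
  by move=> sV x y; rewrite dot_le_Dproj // Dproj_le.
split => //; first by move=> x y; rewrite DplusE // DminusE.
by move=> _ [V sV <-] x y; rewrite DplusE // DminusE // bounds.
Qed.
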